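(* Let $\mathcal{T}=A\oplus(P,g)\oplus Q$ be a triole algebra. A graded derivation of $\mathcal{T}$ of degree $1$ is a pair $X_1=(X_1^A,X_1^P)$ of operators (the restrictions of $X_1$ to $A$ and $P$), with $X_1^A\in D(A,P)$ a $P$-valued derivation of $A$ and $X_1^P:P\to Q$ an element of $\mathrm{Diff}_1(P,Q)$ which satisfies $$X_1^P(ap)=g\big(X_1^A(a),p\big)+aX_1^P(p)\qquad\text{for all }a\in A,\ p\in P.$$
   Context: $\mathbb{K}$ is a field of characteristic zero. A triole algebra $\mathcal{T}=A\oplus(P,g)\oplus Q$ is a $\mathbb{Z}$-graded commutative $\mathbb{K}$-algebra (Koszul sign convention: $st=(-1)^{|s||t|}ts$) with $\mathcal{T}_0=A$ a commutative unital $\mathbb{K}$-algebra, $\mathcal{T}_1=P$ and $\mathcal{T}_2=Q$ $A$-modules, all other components zero; the products $A\cdot A$, $A\cdot P$, $A\cdot Q$ are the algebra and module structures, $p_1\cdot p_2:=g(p_1,p_2)$ for an $A$-bilinear form $g:P\times P\to Q$, and $Q\cdot Q=0$ (also $P\cdot Q=0$ for degree reasons). A graded derivation of degree $i$ is a $\mathbb{K}$-linear map $X:\mathcal{T}\to\mathcal{T}$ with $X(\mathcal{T}_j)\subset\mathcal{T}_{i+j}$ and $X(st)=X(s)t+(-1)^{i|s|}sX(t)$ for homogeneous $s,t$. For an $A$-module $R$, $D(A,R)$ is the module of $\mathbb{K}$-linear derivations $A\to R$. $\mathrm{Diff}_1(P,Q)$ is the module of $\mathbb{K}$-linear differential operators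 $P\to Q$ of order $\le 1$ over $A$, i.e. maps $\Delta$ with $[a,[b,\Delta]]=0$ for all $a,b\in A$ (where $a,b$ denote multiplication operators). *)

(* Defs.v *)
From HB Require Import structures.
From mathcomp Require Import all_boot all_order all_algebra.
From mathcomp Require Import boolp classical_sets functions.

Set Implicit Arguments.
Unset Strict Implicit.
Unset Printing Implicit Defensive.

Import GRing.Theory.
Local Open Scope ring_scope.
Local Open Scope classical_set_scope.

(* A module over the K-algebra A, seen as a K-vector space through K -> A,
   k |-> k%:A. *)
Definition restr_scalars (K : fieldType) (A : comAlgType K) (M : lmodType A) :
  Type := M.

Section RestrScalars.
Variables (K : fieldType) (A : comAlgType K) (M : lmodType A).

HB.instance Definition _ := GRing.Zmodule.on (restr_scalars M).

Let scale (k : K) (m : restr_scalars M) : restr_scalars M :=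
  (k%:A : A) *: (m : M).

Let scaleA a b v : scale a (scale b v) = scale (a * b) v.
Proof. by rewrite /scale scalerA mulr_algl scalerA. Qed.

Let scale1 : left_id 1 scale.
Proof. by move=> v; rewrite /scale !scale1r. Qed.

Let scaleDr : right_distributive scale +%R.
Proof. by move=> k u v; exact: scalerDr. Qed.

Let scaleDl v : {morph scale^~ v : a b / a + b}.
Proof. by move=> a b; rewrite /scale scalerDl [LHS]scalerDl. Qed.

HB.instance Definition _ := GRing.Zmodule_isLmodule.Build K (restr_scalars M)
  scaleA scale1 scaleDr scaleDl.

Lemma restr_scaleE (k : K) (m : restr_scalars M) :
  k *: m = (k%:A : A) *: (m : M).
Proof. by []. Qed.

End RestrScalars.

Section GradedAlgebra.
Variables (K : fieldType) (T : algType K) (T_ : int -> set T).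

Definition koszul_commutative : Prop :=
  forall (i j : int) (s t : T), T_ i s -> T_ j t ->
    s * t = (-1 : K) ^ (i * j) *: (t * s).

Definition graded_derivation (i : int) (X : T -> T) : Prop :=
  [/\ linear X,
      forall j t, T_ j t -> T_ (i + j) (X t) &
      forall j l s t, T_ j s -> T_ l t ->
        X (s * t) = X s * t + (-1 : K) ^ (i * j) *: (s * X t)].

End GradedAlgebra.

(* The underlying algebra depends on g through its product; graded
   commutativity amounts to g being skew-symmetric (triole_commutativeP). *)
Definition triole (K : fieldType) (A : comAlgType K) (P Q : lmodType A)
  (g : {bilinear P -> P -> Q}) : Type :=
  (A * restr_scalars P * restr_scalars Q)%type.

Section Triole.
Variables (K : fieldType) (A : comAlgType K) (P Q : lmodType A).
Variable g : {bilinear P -> P -> Q}.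
Local Notation T := (triole g).

HB.instance Definition _ := GRing.Lmodule.copy T
  (A * restr_scalars P * restr_scalars Q)%type.

Definition prA (t : T) : A := t.1.1.
Definition prP (t : T) : P := t.1.2.
Definition prQ (t : T) : Q := t.2.

Definition Triole (a : A) (p : P) (q : Q) : T := (a, p, q).
Definition inA (a : A) : T := Triole a 0 0.
Definition inP (p : P) : T := Triole 0 p 0.
Definition inQ (q : Q) : T := Triole 0 0 q.

Definition triole_one : T := inA 1.

Definition triole_mul (s t : T) : T :=
  Triole (prA s * prA t)
         (prA s *: prP t + prA t *: prP s)
         (prA s *: prQ t + prA t *: prQ s + g (prP s) (prP t)).

Lemma triole_ind (B : T -> Prop) :
  (forall a p q, B (Triole a p q)) -> forall t, B t.
Proof. by move=> BT [[a p] q]; exact: BT. Qed.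

Lemma eq_triole a a' p p' q q' :
  a = a' -> p = p' -> q = q' -> Triole a p q = Triole a' p' q'.
Proof. by move=> -> -> ->. Qed.

Lemma triole_addE a a' p p' q q' :
  Triole a p q + Triole a' p' q' = Triole (a + a') (p + p') (q + q').
Proof. by []. Qed.

Lemma triole_scaleE (k : K) a p q :
  k *: Triole a p q = Triole (k *: a) (k%:A *: p) (k%:A *: q).
Proof. by []. Qed.

Let mulTE a a' p p' q q' :
  triole_mul (Triole a p q) (Triole a' p' q') =
  Triole (a * a') (a *: p' + a' *: p) (a *: q' + a' *: q + g p p').
Proof. by []. Qed.

Let mulA : associative triole_mul.
Proof.
elim/triole_ind=> a p q; elim/triole_ind=> b p' q'; elim/triole_ind=> c p'' q''.
rewrite !mulTE; apply: eq_triole.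
- exact: mulrA.
- by rewrite !scalerDr !scalerA addrA [c * a]mulrC [c * b]mulrC.
- rewrite linearDr linearDl !linearZr_LR !linearZl_LR /= !scalerDr !scalerA.
  rewrite [c * a]mulrC [c * b]mulrC.
  rewrite -!addrA; congr (_ + (_ + _)).
  by rewrite addrCA; congr (_ + _); rewrite [RHS]addrC -addrA.
Qed.

Let mul1 : left_id triole_one triole_mul.
Proof.
elim/triole_ind=> a p q; rewrite mulTE.
by rewrite mul1r !scale1r !scaler0 linear0l !addr0.
Qed.

Let mulr1' : right_id triole_one triole_mul.
Proof.
elim/triole_ind=> a p q; rewrite mulTE.
by rewrite mulr1 !scale1r !scaler0 linear0r !add0r addr0.
Qed.

Let mulDl : left_distributive triole_mul +%R.
Proof.
elim/triole_ind=> a p q; elim/triole_ind=> b p' q'; elim/triole_ind=> c p'' q''.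
rewrite triole_addE !mulTE triole_addE; apply: eq_triole.
- exact: mulrDl.
- by rewrite scalerDl scalerDr addrACA.
- rewrite linearDl scalerDl scalerDr /=.
  by rewrite [RHS]addrACA; congr (_ + _); rewrite addrACA.
Qed.

Let mulDr : right_distributive triole_mul +%R.
Proof.
elim/triole_ind=> a p q; elim/triole_ind=> b p' q'; elim/triole_ind=> c p'' q''.
rewrite triole_addE !mulTE triole_addE; apply: eq_triole.
- exact: mulrDr.
- by rewrite scalerDl scalerDr addrACA.
- rewrite linearDr scalerDl scalerDr /=.
  by rewrite [RHS]addrACA; congr (_ + _); rewrite addrACA.
Qed.

Let one_neq0 : triole_one != 0.
Proof. by apply/eqP => -[] /eqP; rewrite oner_eq0. Qed.

HB.instance Definition _ := GRing.Zmodule_isNzRing.Build T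
  mulA mul1 mulr1' mulDl mulDr one_neq0.

Lemma triole_mulE a a' p p' q q' :
  Triole a p q * Triole a' p' q' =
  Triole (a * a') (a *: p' + a' *: p) (a *: q' + a' *: q + g p p').
Proof. by []. Qed.

Let scaleAl (k : K) (s t : T) : k *: (s * t) = (k *: s) * t.
Proof.
elim/triole_ind: s => a p q; elim/triole_ind: t => b p' q'.
rewrite triole_scaleE !triole_mulE triole_scaleE; apply: eq_triole.
- exact: scalerAl.
- by rewrite scalerDr !scalerA mulr_algl [b * _]mulrC mulr_algl.
- by rewrite !scalerDr linearZl_LR /= !scalerA mulr_algl [b * _]mulrC mulr_algl.
Qed.

HB.instance Definition _ := GRing.Lmodule_isLalgebra.Build K T scaleAl.

Let scaleAr (k : K) (s t : T) : k *: (s * t) = s * (k *: t).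
Proof.
elim/triole_ind: s => a p q; elim/triole_ind: t => b p' q'.
rewrite triole_scaleE !triole_mulE triole_scaleE; apply: eq_triole.
- exact: scalerAr.
- by rewrite scalerDr !scalerA [a * _]mulrC !mulr_algl.
- by rewrite !scalerDr linearZr_LR /= !scalerA [a * _]mulrC !mulr_algl.
Qed.

HB.instance Definition _ := GRing.Lalgebra_isAlgebra.Build K T scaleAr.

Definition triole_part (i : int) : set T :=
  match i with
  | Posz 0 => range inA
  | Posz 1 => range inP
  | Posz 2 => range inQ
  | _ => [set 0]
  end.

Lemma triole_decomp a p q : Triole a p q = inA a + inP p + inQ q.
Proof. by rewrite !triole_addE ?addr0 ?add0r. Qed.

Ltac triole_simp := rewrite triole_mulE; apply: eq_triole;
  rewrite ?(mul0r, mulr0, scaler0, scale0r, linear0r, linear0l, addr0, add0r).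

Lemma inA_mul a b : inA a * inA b = inA (a * b).
Proof. by triole_simp. Qed.

Lemma inA_inP a p : inA a * inP p = inP (a *: p).
Proof. by triole_simp. Qed.

Lemma inP_inA a p : inP p * inA a = inP (a *: p).
Proof. by triole_simp. Qed.

Lemma inA_inQ a q : inA a * inQ q = inQ (a *: q).
Proof. by triole_simp. Qed.

Lemma inQ_inA a q : inQ q * inA a = inQ (a *: q).
Proof. by triole_simp. Qed.

Lemma inP_mul p1 p2 : inP p1 * inP p2 = inQ (g p1 p2).
Proof. by triole_simp. Qed.

Lemma inP_inQ p q : inP p * inQ q = 0.
Proof. by triole_simp. Qed.

Lemma inQ_inP p q : inQ q * inP p = 0.
Proof. by triole_simp. Qed.

Lemma inQ_mul q1 q2 : inQ q1 * inQ q2 = 0.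
Proof. by triole_simp. Qed.

Lemma triole_partP (i : int) (t : T) : triole_part i t ->
  t = 0 \/ [\/ i = 0 /\ range inA t, i = 1 /\ range inP t |
               i = 2 /\ range inQ t].
Proof.
case: i => [[|[|[|n]]]|n] /=; first [by left | right].
- by constructor 1.
- by constructor 2.
- by constructor 3.
Qed.

Lemma triole_part0 (i : int) : triole_part i 0.
Proof.
case: i => [[|[|[|n]]]|n] //=; first [by exists 0].
Qed.

Lemma triole_part_mul (i j : int) (s t : T) :
  triole_part i s -> triole_part j t -> triole_part (i + j) (s * t).
Proof.
move=> /triole_partP[->|si] tj; first by rewrite mul0r; exact: triole_part0.
move: tj => /triole_partP[->|tj]; first by rewrite mulr0; exact: triole_part0.
case: si => -[-> [x _ <-]]; case: tj => -[-> [y _ <-]].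
- by rewrite inA_mul; exists (x * y).
- by rewrite inA_inP; exists (x *: y).
- by rewrite inA_inQ; exists (x *: y).
- by rewrite inP_inA; exists (y *: x).
- by rewrite inP_mul; exists (g x y).
- by rewrite inP_inQ; exact: triole_part0.
- by rewrite inQ_inA; exists (y *: x).
- by rewrite inQ_inP; exact: triole_part0.
- by rewrite inQ_mul; exact: triole_part0.
Qed.

Lemma triole_commutativeP :
  koszul_commutative triole_part <-> forall p1 p2, g p1 p2 = - g p2 p1.
Proof.
split=> [gC p1 p2|gC i j s t].
  have := gC 1 1 (inP p1) (inP p2); rewrite !inP_mul.
  move=> /(_ (imageP _ I) (imageP _ I)) /(congr1 prQ) /= ->.
  by rewrite mulr1 expr1z scaleN1r.
move=> /triole_partP[->|si]; first by rewrite mul0r mulr0 scaler0.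
move=> /triole_partP[->|tj]; first by rewrite mul0r mulr0 scaler0.
case: si => -[-> [x _ <-]]; case: tj => -[-> [y _ <-]];
  rewrite ?mul0r ?mulr0 ?mulr1 ?mul1r ?expr0z ?scale1r.
- by rewrite !inA_mul mulrC.
- by rewrite inA_inP inP_inA.
- by rewrite inA_inQ inQ_inA.
- by rewrite inA_inP inP_inA.
- rewrite !inP_mul expr1z scaleN1r gC; apply: eq_triole; by rewrite ?oppr0.
- by rewrite inP_inQ inQ_inP scaler0.
- by rewrite inA_inQ inQ_inA.
- by rewrite inP_inQ inQ_inP scaler0.
- by rewrite !inQ_mul scaler0.
Qed.

End Triole.

Arguments triole_part {K A P Q} g i.

Section DifferentialOperators.
Variables (K : fieldType) (A : comAlgType K).

(* D(A, R) *)
Definition derivations (R : lmodType A) : set (A -> R) :=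
  [set X : A -> R | linear (X : A -> restr_scalars R) /\
                    forall a b, X (a * b) = a *: X b + b *: X a].

Variables P Q : lmodType A.

(* [a, D] = a o D - D o a *)
Definition mult_commutator (a : A) (D : P -> Q) : P -> Q :=
  fun p => a *: D p - D (a *: p).

Definition diff_ops1 : set (P -> Q) :=
  [set D : P -> Q | linear (D : restr_scalars P -> restr_scalars Q) /\
    forall a b p, mult_commutator a (mult_commutator b D) p = 0].

End DifferentialOperators.

Section DegreeOne.
Variables (K : fieldType) (A : comAlgType K) (P Q : lmodType A).
Variable g : {bilinear P -> P -> Q}.

(* For X of degree 1, X maps A into P and P into Q, so that these projections
   lose nothing. *)
Definition restrA (X : triole g -> triole g) : A -> P :=
  fun a => prP (X (inA g a)).
Definition restrP (X : triole g -> triole g) : P -> Q :=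
  fun p => prQ (X (inP g p)).

Definition degree1_pairs : set ((A -> P) * (P -> Q)) :=
  [set X | [/\ derivations X.1, diff_ops1 X.2 &
    forall a p, X.2 (a *: p) = g (X.1 a) p + a *: X.2 p]].

End DegreeOne.

(* Main.v *)
Require Import Defs.
From HB Require Import structures.
From mathcomp Require Import all_boot all_order all_algebra.
From mathcomp Require Import boolp classical_sets functions.
Import GRing.Theory.
Local Open Scope ring_scope.
Local Open Scope classical_set_scope.

(* A degree 1 derivation X kills Q, whose image lies in degree 3, so it is
   determined by its restrictions to A and P.  The Leibniz rule on A.A and A.P
   gives the two product formulas; the second says that the commutator [b, X^P]
   is - g(X^A b, -), which is A-linear, whence X^P has order at most 1.
   Conversely (a, p, q) |-> (0, d a, D p) satisfies the Leibniz rule on A.A and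
   A.P by assumption, on P.A by the skew-symmetry of g, and on the remaining
   products because both sides vanish for degree reasons. *)

Section DegreeOneDerivations.
Context {K : fieldType} {A : comAlgType K} {P Q : lmodType A}.
Context {g : {bilinear P -> P -> Q}}.
Implicit Types (X : triole g -> triole g) (d : A -> P) (D : P -> Q).

(** On [degree1_pairs g] this inverts the restriction map. Arbitrary [d] and [D] are allowed, so
    that a derivation can be rebuilt before its restrictions are studied. *)
Definition degree1_ext d D : triole g -> triole g :=
  fun t => Triole g 0 (d (prA t)) (D (prP t)).

(** Linearity enters the definitions as a bare proposition, so additivity is extracted from it
    here. *)
Lemma linear_raddf (U V : lmodType K) (f : U -> V) :
  linear f -> f 0 = 0 /\ {morph f : x y / x + y}.
Proof.
move=> lf; have fD : {morph f : x y / x + y}.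
  by move=> x y; rewrite -[x]scale1r lf !scale1r.
by split=> //; apply: (addrI (f 0)); rewrite -fD !addr0.
Qed.

Lemma degree1_restr X : graded_derivation (triole_part g) 1 X ->
  [/\ forall a, X (inA g a) = inP g (restrA X a),
      forall p, X (inP g p) = inQ g (restrP X p) &
      forall q, X (inQ g q) = 0].
Proof.
case=> _ Xdeg _; split=> [a|p|q].
- have /= [p _ Xa] := Xdeg 0 _ (imageP (inA g) (I : setT a)).
  by rewrite /restrA -Xa.
- have /= [q _ Xp] := Xdeg 1 _ (imageP (inP g) (I : setT p)).
  by rewrite /restrP -Xp.
(* The degree [1 + 2] computes to 3, where the component is [[set 0]]. *)
- exact: (Xdeg 2 _ (imageP (inQ g) (I : setT q))).
Qed.

Lemma degree1_extE X : graded_derivation (triole_part g) 1 X ->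
  X = degree1_ext (restrA X) (restrP X).
Proof.
move=> dX; have [XA XP XQ] := degree1_restr _ dX.
case: dX => /linear_raddf[_ XD] _ _.
apply/funext => t; elim/triole_ind: t => a p q.
rewrite triole_decomp !XD XA XP XQ addr0 triole_addE.
by rewrite addr0 addr0 add0r -triole_decomp.
Qed.

Lemma diff_ops1_leibniz d D :
  linear (D : restr_scalars P -> restr_scalars Q) ->
  (forall a p, D (a *: p) = g (d a) p + a *: D p) -> diff_ops1 D.
Proof.
move=> lD DZ; split=> // a b p.
have commE q : mult_commutator b D q = - g (d b) q.
  by rewrite /mult_commutator DZ opprD addrCA subrr addr0.
by rewrite {1}/mult_commutator !commE linearZr_LR scalerN subrr.
Qed.

Lemma degree1_pairs_restr X : graded_derivation (triole_part g) 1 X ->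
  degree1_pairs g (restrA X, restrP X).
Proof.
move=> dX; have [XA XP XQ] := degree1_restr _ dX; case: dX => lX _ XM.
(* Proved first, since it is both the third condition and the source of the order bound on
   [restrP X]. *)
have XPZ a p : restrP X (a *: p) = g (restrA X a) p + a *: restrP X p.
  have := XM 0 1 _ _ (imageP (inA g) (I : setT a)) (imageP (inP g) (I : setT p)).
  rewrite mulr0 expr0z scale1r inA_inP XA !XP inP_mul inA_inQ.
  by move=> /(congr1 (@prQ _ _ _ _ g)).
split=> //=; last first.
  apply: diff_ops1_leibniz XPZ => k p p'; rewrite /restrP.
  (* The scalar [k] acts on [P] through [restr_scalars], exactly as it does inside the triole, so
     the linearity of [X] applies. *)
  have <- : (k *: inP g p + inP g p' : triole g)
            = inP g (k *: (p : restr_scalars P) + p').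
    by rewrite triole_scaleE triole_addE !(scaler0, addr0).
  by rewrite lX.
split=> [k a b|a b].
  rewrite /restrA.
  have <- : (k *: inA g a + inA g b : triole g) = inA g (k *: a + b).
    by rewrite triole_scaleE triole_addE !(scaler0, addr0).
  by rewrite lX.
have := XM 0 0 _ _ (imageP (inA g) (I : setT a)) (imageP (inA g) (I : setT b)).
rewrite mulr0 expr0z scale1r inA_mul !XA inP_inA inA_inP triole_addE.
by move=> /(congr1 (@prP _ _ _ _ g)); rewrite [prP (Triole _ _ _ _)]addrC.
Qed.

Lemma degree1_ext_derivation d D :
  koszul_commutative (triole_part g) -> degree1_pairs g (d, D) ->
  graded_derivation (triole_part g) 1 (degree1_ext d D).
Proof.
move=> /triole_commutativeP gC [/= [ld dM] [lD _] DZ].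
have [d0 dD] := linear_raddf _ _ _ ld; have [D0 DD] := linear_raddf _ _ _ lD.
have XA a : degree1_ext d D (inA g a) = inP g (d a).
  by rewrite /degree1_ext /= D0.
have XP p : degree1_ext d D (inP g p) = inQ g (D p).
  by rewrite /degree1_ext /= d0.
have XQ q : degree1_ext d D (inQ g q) = 0 by rewrite /degree1_ext /= d0 D0.
have X0 : degree1_ext d D 0 = 0 by rewrite /degree1_ext /= d0 D0.
split.
- move=> k; elim/triole_ind=> a p q; elim/triole_ind=> b p' q'.
  (* Linearity is checked componentwise; the [A]-component is constantly 0. *)
  have z : 0 = k *: 0 + 0 :> A by rewrite scaler0 addr0.
  exact: (eq_triole _ z (ld k a b) (lD k p p')).
- move=> j t /triole_partP[->|]; first by rewrite X0; exact: triole_part0.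
  case=> -[-> [x _ <-]]; rewrite ?XA ?XP ?XQ //=.
  + by exists (d x).
  + by exists (D x).
move=> j l s t /triole_partP[->|sj]; first by rewrite X0 !mul0r scaler0 addr0.
move=> /triole_partP[->|tl]; first by rewrite X0 !mulr0 X0 scaler0 addr0.
(* The sign is evaluated for [j] equal to 0 or 1; for [j = 2] it multiplies a vanishing product. *)
case: sj => -[-> [x _ <-]]; case: tl => -[_ [y _ <-]];
  rewrite ?mulr0 ?mulr1 ?expr0z ?expr1z ?scale1r ?scaleN1r.
- rewrite inA_mul !XA inP_inA inA_inP triole_addE.
  by rewrite !addr0 dM addrC.
- rewrite inA_inP XA !XP inP_mul inA_inQ triole_addE.
  by rewrite !addr0 DZ.
- by rewrite inA_inQ XA !XQ inP_inQ mulr0 addr0.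
(* Here the sign is -1: the rule asks for [y *: D x - g x (d y)], while [DZ] gives
   [g (d y) x + y *: D x]. *)
- rewrite inP_inA XA !XP inP_mul inQ_inA DZ (gC (d y)) addrC.
  by apply: eq_triole => //; apply: esym; apply: subr0.
- by rewrite inP_mul !XP XQ inQ_inP inP_inQ oppr0 addr0.
- by rewrite inP_inQ X0 XP XQ inQ_mul mulr0 oppr0 addr0.
- by rewrite inQ_inA XA !XQ inQ_inP mul0r scaler0 addr0.
- by rewrite inQ_inP X0 XP XQ inQ_mul mul0r scaler0 addr0.
- by rewrite inQ_mul X0 !XQ mul0r mulr0 scaler0 addr0.
Qed.

End DegreeOneDerivations.

Theorem lemma3p15 (K : fieldType) (charK : [pchar K] =i pred0)
  (A : comAlgType K) (P Q : lmodType A) (g : {bilinear P -> P -> Q})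
  (gC : koszul_commutative (triole_part g)) :
  (forall X : triole g -> triole g,
     graded_derivation (triole_part g) 1 X ->
     (forall a, X (inA g a) = inP g (restrA X a)) /\
     (forall p, X (inP g p) = inQ g (restrP X p))) /\
  set_bij [set X | graded_derivation (triole_part g) 1 X]
          (degree1_pairs g)
          (fun X => (restrA X, restrP X)).
Proof.
split=> [X dX|]; first by have [XA XP _] := degree1_restr _ dX.
split.
- exact: degree1_pairs_restr.
- move=> X Y; rewrite !inE => dX dY [eqA eqP].
  by rewrite (degree1_extE _ dX) (degree1_extE _ dY) eqA eqP.
(* The restrictions of [degree1_ext d D] compute to [d] and [D]. *)
- move=> [d D] dD; exists (degree1_ext d D) => //.
  exact: degree1_ext_derivation.
Qed.
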